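(* Let $\mathbb{C}$ be a regular category. The following conditions are equivalent: (i) $\mathbb{C}$ is a Goursat category; (ii) the Shifting Lemma holds in $\mathbb{C}$ when $S$ is a reflexive relation and $R$ and $T$ are reflexive and positive relations; that is, for every object $X$ of $\mathbb{C}$, every reflexive relation $S$ on $X$ and all reflexive and positive relations $R,T$ on $X$ with $R\wedge S\leqslant T$, whenever $x,y,u,v$ are (generalised) elements of $X$ with $(x,y)\in R\wedge T$, $(x,u)\in S$, $(y,v)\in S$ and $(u,v)\in R$, one has $(u,v)\in T$.
   Context: A category with finite limits is regular if every morphism factors as a regular epimorphism (a coequaliser of some parallel pair) followed by a monomorphism, and regular epimorphisms are stable under pullback. An (internal) relation $R$ from $X$ to $Y$ is a subobject $\langle r_1,r_2\rangle\colon R\rightarrowtail X\times Y$; a relation on $X$ is a relation from $X$ to $X$. For relations, $\leqslant$ denotes inclusion of subobjects and $\wedge$ denotes their intersection (meet of subobjects). For morphisms $x\colon A\to X$, $y\colon A\to Y$ with a common arbitrary domain $A$ (generalised elements), $(x,y)\in R$ means that $\langle x,y\rangle\colon A\to X\times Y$ factors through $R$. The opposite $R^\circ$ is the subobject $\langle r_2,r_1\rangle\colon R\rightarrowtail Y\times X$. For relations $R\rightarrowtail X\times Y$ and $S\rightarrowtail Y\times Z$ in a regular category, the composite $SR\rightarrowtail X\times Z$ (first $R$, then $S$) is the image, in the (regular epimorphism, monomorphism) factorization, of $\langle r_1\pi_1,s_2\pi_2\rangle\colon R\times_Y S\to X\times Z$, where $R\times_Y S$ is the pullback of $r_2$ and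 $s_1$. A relation $R$ on $X$ is reflexive if $1_X\leqslant R$, where $1_X$ is the diagonal $\langle 1_X,1_X\rangle\colon X\rightarrowtail X\times X$; symmetric if $R^\circ\leqslant R$; transitive if $RR\leqslant R$; and an equivalence relation if it is reflexive, symmetric and transitive. A relation $P$ on $X$ is positive if $P=U^\circ U$ for some object $Y$ and some relation $U\rightarrowtail X\times Y$. A regular category $\mathbb{C}$ is a Goursat category if it is $3$-permutable, i.e. $RSR=SRS$ for any pair of equivalence relations $R,S$ on the same object of $\mathbb{C}$. *)

(* Defs.v *)
(* Morphisms are compared by Leibniz equality.  A subobject is
   given by a representing monomorphism; equality of subobjects is [sub_eq], i.e.
   inclusion both ways.  Existence assertions about a category are kept in
   Prop, and representatives (products, pullbacks, images) are selected with
   [constructive_indefinite_description]. *)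
From Stdlib Require Import List Bool Eqdep_dec FinFun ClassicalEpsilon.

Set Implicit Arguments.
Unset Strict Implicit.
Unset Printing Implicit Defensive.

Declare Scope cat_scope.
Delimit Scope cat_scope with cat.
Local Open Scope cat_scope.

Record category := Category {
  ob :> Type;
  hom : ob -> ob -> Type;
  idm : forall X, hom X X;
  comp : forall X Y Z, hom Y Z -> hom X Y -> hom X Z;
  comp_id_l : forall X Y (f : hom X Y), comp (idm Y) f = f;
  comp_id_r : forall X Y (f : hom X Y), comp f (idm X) = f;
  comp_assoc : forall W X Y Z (h : hom Y Z) (g : hom X Y) (f : hom W X),
    comp h (comp g f) = comp (comp h g) f
}.

Arguments hom {c} X Y.
Arguments idm {c} X.
Arguments comp {c X Y Z} g f : rename.

Notation "g ∘ f" := (comp g f) (at level 40, left associativity) : cat_scope.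

Record functor (J C : category) := Functor {
  fob :> J -> C;
  fmap : forall i j : J, hom i j -> hom (fob i) (fob j);
  fmap_id : forall i : J, fmap (idm i) = idm (fob i);
  fmap_comp : forall (i j k : J) (b : hom j k) (a : hom i j),
    fmap (b ∘ a) = fmap b ∘ fmap a
}.

Arguments fmap {J C} D {i j} a : rename.

Definition finite_category (J : category) : Prop :=
  Finite J /\ forall i j : J, Finite (hom i j).

Section Categories.
Variable C : category.

Definition is_cone (J : category) (D : functor J C) (L : C)
    (p : forall j : J, hom L (D j)) : Prop :=
  forall (i j : J) (a : hom i j), fmap D a ∘ p i = p j.

Definition is_limit (J : category) (D : functor J C) (L : C)
    (p : forall j : J, hom L (D j)) : Prop :=
  is_cone p /\
  forall (A : C) (q : forall j : J, hom A (D j)), is_cone q ->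
    exists! h : hom A L, forall j, p j ∘ h = q j.

Definition has_finite_limits : Prop :=
  forall J : category, finite_category J -> forall D : functor J C,
    exists (L : C) (p : forall j : J, hom L (D j)), is_limit p.

Definition is_product (X Y P : C) (p1 : hom P X) (p2 : hom P Y) : Prop :=
  forall (A : C) (f : hom A X) (g : hom A Y),
    exists! h : hom A P, p1 ∘ h = f /\ p2 ∘ h = g.

Definition is_pullback (X Y Z P : C) (f : hom X Z) (g : hom Y Z)
    (p : hom P X) (q : hom P Y) : Prop :=
  f ∘ p = g ∘ q /\
  forall (A : C) (a : hom A X) (b : hom A Y), f ∘ a = g ∘ b ->
    exists! h : hom A P, p ∘ h = a /\ q ∘ h = b.

Definition is_coequaliser (X Y Q : C) (a b : hom X Y) (e : hom Y Q) : Prop :=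
  e ∘ a = e ∘ b /\
  forall (Z : C) (g : hom Y Z), g ∘ a = g ∘ b ->
    exists! h : hom Q Z, h ∘ e = g.

Definition monic (X Y : C) (m : hom X Y) : Prop :=
  forall (A : C) (g h : hom A X), m ∘ g = m ∘ h -> g = h.

Definition regular_epi (X Y : C) (e : hom X Y) : Prop :=
  exists (A : C) (a b : hom A X), is_coequaliser a b e.

Definition regular : Prop :=
  has_finite_limits /\
  (forall (X Y : C) (f : hom X Y),
    exists (I : C) (e : hom X I) (m : hom I Y),
      regular_epi e /\ monic m /\ m ∘ e = f) /\
  (forall (X Y Z P : C) (f : hom X Z) (g : hom Y Z)
      (p : hom P X) (q : hom P Y),
    is_pullback f g p q -> regular_epi f -> regular_epi q).

End Categories.

Record regular_category := RegularCategory {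
  reg_cat :> category;
  reg_ax : regular reg_cat
}.

Lemma finite_is_true (b : bool) : Finite (is_true b).
Proof.
destruct b.
- exists (eq_refl :: nil). intro a. left. apply UIP_dec, bool_dec.
- exists nil. intro a. discriminate a.
Qed.

Section PreorderCategory.
Variables (T : Type) (r : T -> T -> bool).
Hypothesis r_refl : forall x, is_true (r x x).
Hypothesis r_trans : forall x y z,
  is_true (r y z) -> is_true (r x y) -> is_true (r x z).

Definition preorder_category : category.
Proof.
refine (@Category T (fun x y => is_true (r x y)) r_refl r_trans _ _ _);
  intros; apply UIP_dec, bool_dec.
Defined.

Lemma finite_preorder_category :
  Finite T -> finite_category preorder_category.
Proof. intro H; split; [exact H | intros i j; apply finite_is_true]. Qed.

End PreorderCategory.

Definition pair_shape : category.
Proof.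
refine (@preorder_category bool Bool.eqb _ _).
- intros []; reflexivity.
- intros [] [] []; auto.
Defined.

(* [None] is the common codomain of [Some true] and [Some false]. *)
Definition cospan_le (i j : option bool) : bool :=
  match i, j with
  | _, None => true
  | Some a, Some b => Bool.eqb a b
  | None, Some _ => false
  end.

Definition cospan_shape : category.
Proof.
refine (@preorder_category (option bool) cospan_le _ _).
- intros [[]|]; reflexivity.
- intros [[]|] [[]|] [[]|]; simpl; auto; discriminate.
Defined.

Lemma finite_pair_shape : finite_category pair_shape.
Proof.
apply finite_preorder_category.
exists (true :: false :: nil). intros []; simpl; auto.
Qed.

Lemma finite_cospan_shape : finite_category cospan_shape.
Proof.
apply finite_preorder_category.
exists (None :: Some true :: Some false :: nil). intros [[]|]; simpl; auto.
Qed.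

Section FiniteLimits.
Variable C : category.
Hypothesis HC : has_finite_limits C.

Lemma has_products (X Y : C) :
  exists (P : C) (p1 : hom P X) (p2 : hom P Y), is_product p1 p2.
Proof.
pose (o := fun b : pair_shape => if b then X else Y).
assert (m : forall i j : pair_shape, hom i j -> hom (o i) (o j)).
{ intros [] [] h; first [exact (idm _) | discriminate h]. }
pose (m' := fun (i j : bool) =>
  match i, j return @hom pair_shape i j -> hom (o i) (o j) with
  | true, true => fun _ => idm X
  | false, false => fun _ => idm Y
  | i, j => m i j
  end).
assert (F1 : forall i, @m' i i (@idm pair_shape i) = idm (o i)) by (intros []; reflexivity).
assert (F2 : forall (i j k : pair_shape) (b : hom j k) (a : hom i j),
  @m' i k (b ∘ a) = @m' j k b ∘ @m' i j a).
{ intros [] [] [] b a;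
    first [discriminate a | discriminate b | symmetry; apply comp_id_l]. }
destruct (HC finite_pair_shape (@Functor pair_shape C o m' F1 F2)) as (P & p & _ & Hp).
exists P, (p true), (p false). intros A f g.
destruct (Hp A (fun b : bool => if b return hom A (o b) then f else g))
  as (h & Hh & Uh).
- intros [] [] a; first [discriminate a | apply comp_id_l].
- exists h; split.
  + exact (conj (Hh true) (Hh false)).
  + intros h' [H1 H2]; apply Uh; intros []; assumption.
Qed.

Lemma has_pullbacks (X Y Z : C) (f : hom X Z) (g : hom Y Z) :
  exists (P : C) (p : hom P X) (q : hom P Y), is_pullback f g p q.
Proof.
pose (o := fun i : cospan_shape =>
  match i with None => Z | Some true => X | Some false => Y end).
assert (m : forall i j : cospan_shape, hom i j -> hom (o i) (o j)).
{ intros [[]|] [[]|] h;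
    first [exact (idm _) | exact f | exact g | discriminate h]. }
pose (m' := fun (i j : option bool) =>
  match i, j return @hom cospan_shape i j -> hom (o i) (o j) with
  | None, None => fun _ => idm Z
  | Some true, Some true => fun _ => idm X
  | Some false, Some false => fun _ => idm Y
  | Some true, None => fun _ => f
  | Some false, None => fun _ => g
  | i, j => m i j
  end).
assert (F1 : forall i, @m' i i (@idm cospan_shape i) = idm (o i))
  by (intros [[]|]; reflexivity).
assert (F2 : forall (i j k : cospan_shape) (b : hom j k) (a : hom i j),
  @m' i k (b ∘ a) = @m' j k b ∘ @m' i j a).
{ intros [[]|] [[]|] [[]|] b a;
    first [ discriminate a | discriminate b
          | symmetry; apply comp_id_l | symmetry; apply comp_id_r ]. }
destruct (HC finite_cospan_shape (@Functor cospan_shape C o m' F1 F2)) as (P & p & Hc & Hp).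
pose proof (Hc (Some true) None eq_refl) as E1; simpl in E1.
pose proof (Hc (Some false) None eq_refl) as E2; simpl in E2.
exists P, (p (Some true)), (p (Some false)). split.
- exact (eq_trans E1 (eq_sym E2)).
- intros A a b E.
  destruct (Hp A (fun i : option bool =>
    match i return hom A (o i) with
    | None => f ∘ a | Some true => a | Some false => b end)) as (h & Hh & Uh).
  + intros [[]|] [[]|] c;
      first [discriminate c | apply comp_id_l | reflexivity
            | symmetry; exact E].
  + exists h; split.
    * exact (conj (Hh (Some true)) (Hh (Some false))).
    * intros h' [H1 H2]; apply Uh; intros [[]|]; try assumption.
      rewrite <- E1, <- comp_assoc; f_equal; assumption.
Qed.

End FiniteLimits.

Record product_data (C : category) (X Y : C) := ProductData {
  prod_ob : C;
  prod_pr1 : hom prod_ob X;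
  prod_pr2 : hom prod_ob Y;
  prod_data_ax : is_product prod_pr1 prod_pr2
}.

Record pullback_data (C : category) (X Y Z : C) (f : hom X Z) (g : hom Y Z) :=
  PullbackData {
    pb_ob : C;
    pb_fst : hom pb_ob X;
    pb_snd : hom pb_ob Y;
    pb_data_ax : is_pullback f g pb_fst pb_snd
  }.

Record subobject (C : category) (Z : C) := Subobject {
  dom : C;
  incl : hom dom Z;
  incl_monic : monic incl
}.

Arguments dom {C Z} A : rename.
Arguments incl {C Z} A : rename.
Arguments incl_monic {C Z} A : rename.

Record image_data (C : category) (X Y : C) (f : hom X Y) := ImageData {
  im_sub : subobject Y;
  im_cover : hom X (dom im_sub);
  im_cover_regular : regular_epi im_cover;
  im_fact : incl im_sub ∘ im_cover = f
}.

Definition choose (A : Type) (H : inhabited A) : A :=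
  proj1_sig (constructive_indefinite_description (fun _ : A => True)
    (match H with inhabits a => ex_intro _ a I end)).

Section Chosen.
Variable C : regular_category.

Lemma product_inhabited (X Y : C) : inhabited (product_data X Y).
Proof.
destruct (has_products (proj1 (reg_ax C)) X Y) as (P & p1 & p2 & H).
exact (inhabits (ProductData H)).
Qed.

Lemma pullback_inhabited (X Y Z : C) (f : hom X Z) (g : hom Y Z) :
  inhabited (pullback_data f g).
Proof.
destruct (has_pullbacks (proj1 (reg_ax C)) f g) as (P & p & q & H).
exact (inhabits (PullbackData H)).
Qed.

Lemma image_inhabited (X Y : C) (f : hom X Y) : inhabited (image_data f).
Proof.
destruct (proj1 (proj2 (reg_ax C)) X Y f) as (I & e & m & He & Hm & E).
exact (inhabits (@ImageData C X Y f (Subobject Hm) e He E)).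
Qed.

Definition product (X Y : C) : C := prod_ob (choose (product_inhabited X Y)).
Definition pr1 (X Y : C) : hom (product X Y) X :=
  prod_pr1 (choose (product_inhabited X Y)).
Definition pr2 (X Y : C) : hom (product X Y) Y :=
  prod_pr2 (choose (product_inhabited X Y)).

Lemma productP (X Y : C) : is_product (pr1 X Y) (pr2 X Y).
Proof. exact (prod_data_ax (choose (product_inhabited X Y))). Qed.

Definition pairing (A X Y : C) (x : hom A X) (y : hom A Y) :
    hom A (product X Y) :=
  proj1_sig (constructive_definite_description _ (productP x y)).

Lemma pr1_pairing (A X Y : C) (x : hom A X) (y : hom A Y) :
  pr1 X Y ∘ pairing x y = x.
Proof.
exact (proj1 (proj2_sig (constructive_definite_description _ (productP x y)))).
Qed.

Lemma pr2_pairing (A X Y : C) (x : hom A X) (y : hom A Y) :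
  pr2 X Y ∘ pairing x y = y.
Proof.
exact (proj2 (proj2_sig (constructive_definite_description _ (productP x y)))).
Qed.

Lemma product_ext (A X Y : C) (g h : hom A (product X Y)) :
  pr1 X Y ∘ g = pr1 X Y ∘ h -> pr2 X Y ∘ g = pr2 X Y ∘ h -> g = h.
Proof.
intros E1 E2.
destruct (productP (pr1 X Y ∘ h) (pr2 X Y ∘ h)) as (k & _ & U).
rewrite <- (U g (conj E1 E2)); apply U; split; reflexivity.
Qed.

Definition pullback (X Y Z : C) (f : hom X Z) (g : hom Y Z) : C :=
  pb_ob (choose (pullback_inhabited f g)).
Definition pb1 (X Y Z : C) (f : hom X Z) (g : hom Y Z) :
  hom (pullback f g) X := pb_fst (choose (pullback_inhabited f g)).
Definition pb2 (X Y Z : C) (f : hom X Z) (g : hom Y Z) :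
  hom (pullback f g) Y := pb_snd (choose (pullback_inhabited f g)).

Lemma pullbackP (X Y Z : C) (f : hom X Z) (g : hom Y Z) :
  is_pullback f g (pb1 f g) (pb2 f g).
Proof. exact (pb_data_ax (choose (pullback_inhabited f g))). Qed.

Definition image (X Y : C) (f : hom X Y) : subobject Y :=
  im_sub (choose (image_inhabited f)).

Lemma imageP (X Y : C) (f : hom X Y) :
  exists e : hom X (dom (image f)), regular_epi e /\ incl (image f) ∘ e = f.
Proof.
exists (im_cover (choose (image_inhabited f))); split.
- apply im_cover_regular.
- apply im_fact.
Qed.

Definition sub_le (Z : C) (A B : subobject Z) : Prop :=
  exists k : hom (dom A) (dom B), incl B ∘ k = incl A.

Definition sub_eq (Z : C) (A B : subobject Z) : Prop := sub_le A B /\ sub_le B A.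

Lemma meet_monic (Z : C) (A B : subobject Z) :
  monic (incl A ∘ pb1 (incl A) (incl B)).
Proof.
destruct (pullbackP (incl A) (incl B)) as [Sq U].
intros W g h E.
assert (E1 : pb1 (incl A) (incl B) ∘ g = pb1 (incl A) (incl B) ∘ h).
{ apply (incl_monic A). rewrite !comp_assoc. exact E. }
assert (E2 : pb2 (incl A) (incl B) ∘ g = pb2 (incl A) (incl B) ∘ h).
{ apply (incl_monic B). rewrite !comp_assoc, <- Sq. exact E. }
destruct (U W (pb1 (incl A) (incl B) ∘ h) (pb2 (incl A) (incl B) ∘ h))
  as (k & _ & Uk).
{ rewrite !comp_assoc, Sq. reflexivity. }
rewrite <- (Uk g (conj E1 E2)); apply Uk; split; reflexivity.
Qed.

Definition meet (Z : C) (A B : subobject Z) : subobject Z :=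
  Subobject (@meet_monic Z A B).

Definition relation (X Y : C) := subobject (product X Y).

Definition leg1 (X Y : C) (R : relation X Y) : hom (dom R) X :=
  pr1 X Y ∘ incl R.
Definition leg2 (X Y : C) (R : relation X Y) : hom (dom R) Y :=
  pr2 X Y ∘ incl R.

Definition related (X Y A : C) (R : relation X Y) (x : hom A X) (y : hom A Y)
    : Prop :=
  exists k : hom A (dom R), incl R ∘ k = pairing x y.

Lemma diag_monic (X : C) : monic (pairing (idm X) (idm X)).
Proof.
intros A g h E.
rewrite <- (comp_id_l g), <- (comp_id_l h), <- (pr1_pairing (idm X) (idm X)).
rewrite <- !comp_assoc, E. reflexivity.
Qed.

Definition diag (X : C) : relation X X := Subobject (@diag_monic X).

Lemma opp_monic (X Y : C) (R : relation X Y) :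
  monic (pairing (leg2 R) (leg1 R)).
Proof.
intros A g h E. apply (incl_monic R), product_ext.
- rewrite !comp_assoc. fold (leg1 R).
  rewrite <- (pr2_pairing (leg2 R) (leg1 R)), <- !comp_assoc, E. reflexivity.
- rewrite !comp_assoc. fold (leg2 R).
  rewrite <- (pr1_pairing (leg2 R) (leg1 R)), <- !comp_assoc, E. reflexivity.
Qed.

Definition opp (X Y : C) (R : relation X Y) : relation Y X :=
  Subobject (@opp_monic X Y R).

(* [rcomp S R] is the composite SR: first R, then S. *)
Definition rcomp (X Y Z : C) (S : relation Y Z) (R : relation X Y) :
    relation X Z :=
  image (pairing (leg1 R ∘ pb1 (leg2 R) (leg1 S))
                 (leg2 S ∘ pb2 (leg2 R) (leg1 S))).

Definition reflexive (X : C) (R : relation X X) : Prop := sub_le (diag X) R.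
Definition symmetric (X : C) (R : relation X X) : Prop := sub_le (opp R) R.
Definition transitive (X : C) (R : relation X X) : Prop := sub_le (rcomp R R) R.

Definition equivalence (X : C) (R : relation X X) : Prop :=
  reflexive R /\ symmetric R /\ transitive R.

Definition positive (X : C) (P : relation X X) : Prop :=
  exists (Y : C) (U : relation X Y), sub_eq P (rcomp (opp U) U).

Definition goursat : Prop :=
  forall (X : C) (R S : relation X X), equivalence R -> equivalence S ->
    sub_eq (rcomp R (rcomp S R)) (rcomp S (rcomp R S)).

Definition shifting_lemma (X : C) (R S T : relation X X) : Prop :=
  sub_le (meet R S) T ->
  forall (A : C) (x y u v : hom A X),
    related (meet R T) x y -> related S x u -> related S y v ->
    related R u v -> related T u v.

End Chosen.

(* Main.v *)
Require Import Defs.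

(** The whole argument is carried out with generalised elements.  In a regular
    category [(x, z)] lies in a composite [SR] exactly when, after restriction
    along some regular epimorphism, an intermediate element [y] exists
    ([related_rcomp]); and membership in a relation may be tested after such a
    restriction ([regular_epi_cover]), so a cover introduced by an existential
    statement can always be discarded when the goal is a membership.

    From the Shifting Lemma to the Goursat property.  For any reflexive relation
    [E], the relations [R = E°E] and [T = EE°] are reflexive and positive, and
    [E° ≤ T].  If [(u, v)] is in [E°E], say [u E p] and [v E p], then the
    configuration [x = y = p] with [S = E°] satisfies the premises of the
    Shifting Lemma, whose conclusion is [(u, v) ∈ EE°].  Thus [E°E ≤ EE°]
    ([shifting_swap]).  For equivalence relations [R] and [S] one takes
    [E = SR]: then [E°E = RSSR = RSR] and [EE° = SRRS = SRS].

    From the Goursat property to the Shifting Lemma.  Applying 3-permutability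
    to the kernel pairs of two morphisms [f] and [g] with the same domain [D]
    turns a zigzag [d0, d1, d2, d3] in [D] whose steps are identified by [f],
    [g], [f] into one with the same ends whose steps are identified by [g], [f],
    [g] ([goursat_zigzag]).  This is used twice.

    For [D] the span of a relation [U] it says that [U°U] is transitive, so that
    reflexive positive relations are equivalence relations
    ([goursat_positive_transitive]).

    For the Shifting Lemma itself let [D] consist of the quadruples
    [(z, m, w, t)] with [z S m], [z (R ∧ T) w] and [m R t], and let
    [f(z, m, w, t) = m] and [g(z, m, w, t) = (w, t)].  The zigzag

      [(u, u, u, u), (x, u, x, u), (y, v, x, u), (v, v, v, u)]

    yields elements [(z, m, u, u)] and [(z', m, v, u)] of [D].  As
    [z R u R m] and [z S m], the hypothesis [R ∧ S ≤ T] gives [z T m], and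
    [z' T m] in the same way; hence [u T z T m T z' T v].

    In a variety this is the following computation.  The Goursat property there
    means that there are terms [r] and [s] with [r(a,b,b) = a],
    [r(a,a,b) = s(a,b,b)] and [s(a,a,b) = b], and the elements above are
    [m = r(u,u,v) = s(u,v,v)], [z = r(u,x,y)] and [z' = s(x,y,v)]. *)

Set Implicit Arguments.
Unset Strict Implicit.
Unset Printing Implicit Defensive.

Local Open Scope cat_scope.

Section Elements.
Variable C : regular_category.

(** * Generalised elements of relations *)

Lemma pairing_comp (A B X Y : C) (x : hom A X) (y : hom A Y) (f : hom B A) :
  pairing x y ∘ f = pairing (x ∘ f) (y ∘ f).
Proof.
apply product_ext; rewrite comp_assoc.
- rewrite !pr1_pairing; reflexivity.
- rewrite !pr2_pairing; reflexivity.
Qed.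

Lemma relatedP (X Y A : C) (R : relation X Y) (x : hom A X) (y : hom A Y) :
  related R x y <->
  exists k : hom A (dom R), leg1 R ∘ k = x /\ leg2 R ∘ k = y.
Proof.
unfold leg1, leg2; split.
- intros [k E]; exists k; rewrite <- !comp_assoc, E.
  split; [apply pr1_pairing | apply pr2_pairing].
- intros (k & E1 & E2); exists k; apply product_ext; rewrite comp_assoc.
  + rewrite pr1_pairing; exact E1.
  + rewrite pr2_pairing; exact E2.
Qed.

Lemma related_legs (X Y A : C) (R : relation X Y) (k : hom A (dom R)) :
  related R (leg1 R ∘ k) (leg2 R ∘ k).
Proof. apply relatedP; exists k; split; reflexivity. Qed.

Lemma related_comp (X Y A B : C) (R : relation X Y) (x : hom A X) (y : hom A Y)
    (f : hom B A) :
  related R x y -> related R (x ∘ f) (y ∘ f).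
Proof.
intros [k E]; exists (k ∘ f); rewrite comp_assoc, E; apply pairing_comp.
Qed.

Lemma related_le (X Y A : C) (R S : relation X Y) (x : hom A X) (y : hom A Y) :
  sub_le R S -> related R x y -> related S x y.
Proof.
intros [j Ej] [k Ek]; exists (j ∘ k); rewrite comp_assoc, Ej; exact Ek.
Qed.

Lemma sub_le_related (X Y : C) (R S : relation X Y) :
  (forall (A : C) (x : hom A X) (y : hom A Y), related R x y -> related S x y) ->
  sub_le R S.
Proof.
intro H.
destruct (H _ _ _ (related_legs (R := R) (idm _))) as [k Ek].
exists k; rewrite Ek, <- pairing_comp, comp_id_r.
apply product_ext; [apply pr1_pairing | apply pr2_pairing].
Qed.

Lemma related_meet (X Y A : C) (R S : relation X Y) (x : hom A X) (y : hom A Y) :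
  related (meet R S) x y <-> related R x y /\ related S x y.
Proof.
destruct (pullbackP (incl R) (incl S)) as [Sq U]; split.
- intros [k Ek]; simpl in Ek; split.
  + exists (pb1 _ _ ∘ k); rewrite comp_assoc; exact Ek.
  + exists (pb2 _ _ ∘ k); rewrite comp_assoc, <- Sq; exact Ek.
- intros [[j Ej] [k Ek]].
  destruct (U A j k) as (h & [E1 _] & _); [rewrite Ej, Ek; reflexivity|].
  exists h; simpl; rewrite <- comp_assoc, E1; exact Ej.
Qed.

Lemma related_opp (X Y A : C) (R : relation X Y) (x : hom A X) (y : hom A Y) :
  related (opp R) y x <-> related R x y.
Proof.
rewrite !relatedP; unfold leg1 at 1, leg2 at 1; simpl.
rewrite pr1_pairing, pr2_pairing.
split; intros (k & E1 & E2); exists k; split; assumption.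
Qed.

Lemma reflexive_related (X A : C) (R : relation X X) (x : hom A X) :
  reflexive R -> related R x x.
Proof.
intro H; apply (related_le H); exists x; simpl.
rewrite pairing_comp, comp_id_l; reflexivity.
Qed.

Lemma related_reflexive (X : C) (R : relation X X) :
  (forall (A : C) (x : hom A X), related R x x) -> reflexive R.
Proof.
intro H; destruct (H X (idm X)) as [k Ek]; exists k; exact Ek.
Qed.

(** * Regular epimorphisms as covers *)

(** A regular epimorphism [e] is orthogonal to every monomorphism [m]: since
    [m] reflects the equality of the two morphisms that [e] coequalises, the
    top side of a commutative square from [e] to [m] factors through [e]. *)
Lemma regular_epi_lift (X Y Z W : C) (e : hom X Y) (m : hom Z W)
    (h : hom X Z) (g : hom Y W) :
  regular_epi e -> monic m -> m ∘ h = g ∘ e -> exists k : hom Y Z, m ∘ k = g.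
Proof.
intros (A & a & b & Ee & U) Hm Sq.
destruct (U Z h) as (k & Ek & _).
{ apply Hm; rewrite !comp_assoc, Sq, <- !comp_assoc, Ee; reflexivity. }
exists k.
destruct (U W (g ∘ e)) as (l & _ & Ul).
{ rewrite <- !comp_assoc, Ee; reflexivity. }
rewrite <- (Ul (m ∘ k)).
- apply Ul; reflexivity.
- rewrite <- comp_assoc, Ek; exact Sq.
Qed.

(** The one property of regular epimorphisms that the element-wise proofs rely
    on.  It is visibly stable under composition, so that covers arising from
    successive existential statements can be merged into one. *)
Definition cover (A B : C) (e : hom B A) : Prop :=
  forall (X Y : C) (R : relation X Y) (x : hom A X) (y : hom A Y),
    related R (x ∘ e) (y ∘ e) -> related R x y.

Lemma regular_epi_cover (A B : C) (e : hom B A) : regular_epi e -> cover e.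
Proof.
intros He X Y R x y [k Ek].
apply (regular_epi_lift He (incl_monic R) (h := k)).
rewrite Ek, pairing_comp; reflexivity.
Qed.

Lemma cover_comp (A B D : C) (e : hom B A) (e' : hom D B) :
  cover e -> cover e' -> cover (e ∘ e').
Proof.
intros He He' X Y R x y H; apply He, He'; rewrite <- !comp_assoc; exact H.
Qed.

Lemma rcomp_intro (X Y Z A : C) (R : relation X Y) (S : relation Y Z)
    (x : hom A X) (y : hom A Y) (z : hom A Z) :
  related R x y -> related S y z -> related (rcomp S R) x z.
Proof.
intros HR HS; rewrite relatedP in HR, HS.
destruct HR as (j & Ex & Ey), HS as (k & Ey' & Ez).
destruct (pullbackP (leg2 R) (leg1 S)) as [_ U].
destruct (U A j k) as (h & [E1 E2] & _); [rewrite Ey, Ey'; reflexivity|].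
unfold rcomp.
destruct (imageP (pairing (leg1 R ∘ pb1 (leg2 R) (leg1 S))
                          (leg2 S ∘ pb2 (leg2 R) (leg1 S)))) as (e & _ & Ee).
exists (e ∘ h); rewrite comp_assoc, Ee, pairing_comp, <- !comp_assoc, E1, E2.
rewrite Ex, Ez; reflexivity.
Qed.

(** The cover is the pullback, along the element [k] of the image, of the regular
    epimorphism onto the image: this is where the stability of regular
    epimorphisms enters. *)
Lemma image_elim (X Y A : C) (f : hom X Y) (k : hom A (dom (image f))) :
  exists (B : C) (e : hom B A) (b : hom B X),
    cover e /\ f ∘ b = incl (image f) ∘ k ∘ e.
Proof.
destruct (imageP f) as (q & Hq & Eq).
pose proof (pullbackP q k) as Hp.
exists (pullback q k), (pb2 q k), (pb1 q k); split.
- exact (regular_epi_cover (proj2 (proj2 (reg_ax C)) _ _ _ _ _ _ _ _ Hp Hq)).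
- transitivity (incl (image f) ∘ q ∘ pb1 q k).
  + rewrite Eq; reflexivity.
  + rewrite <- !comp_assoc, (proj1 Hp); reflexivity.
Qed.

Lemma rcomp_elim (X Y Z A : C) (R : relation X Y) (S : relation Y Z)
    (x : hom A X) (z : hom A Z) :
  related (rcomp S R) x z ->
  exists (B : C) (e : hom B A) (y : hom B Y),
    cover e /\ related R (x ∘ e) y /\ related S y (z ∘ e).
Proof.
unfold rcomp; intros [k Ek].
destruct (image_elim k) as (B & e & b & He & E).
rewrite Ek, !pairing_comp in E.
pose proof (f_equal (fun h => pr1 _ _ ∘ h) E) as E1.
pose proof (f_equal (fun h => pr2 _ _ ∘ h) E) as E2.
simpl in E1, E2; rewrite !pr1_pairing in E1; rewrite !pr2_pairing in E2.
exists B, e, (leg2 R ∘ (pb1 (leg2 R) (leg1 S) ∘ b)).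
split; [exact He|]; split.
- rewrite <- E1, <- comp_assoc; apply related_legs.
- rewrite <- E2, <- comp_assoc, comp_assoc, (proj1 (pullbackP _ _)), <- comp_assoc.
  apply related_legs.
Qed.

Lemma related_rcomp (X Y Z A : C) (R : relation X Y) (S : relation Y Z)
    (x : hom A X) (z : hom A Z) :
  related (rcomp S R) x z <->
  exists (B : C) (e : hom B A) (y : hom B Y),
    cover e /\ related R (x ∘ e) y /\ related S y (z ∘ e).
Proof.
split; [apply rcomp_elim|].
intros (B & e & y & He & HR & HS).
exact (He _ _ _ _ _ (rcomp_intro HR HS)).
Qed.

Lemma related_symmetric (X : C) (R : relation X X) :
  symmetric R <->
  forall (A : C) (x y : hom A X), related R x y -> related R y x.
Proof.
split.
- intros H A x y Hxy; apply (related_le H), related_opp; exact Hxy.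
- intro H; apply sub_le_related; intros A x y Hxy.
  apply H, related_opp; exact Hxy.
Qed.

Lemma related_transitive (X : C) (R : relation X X) :
  transitive R <->
  forall (A : C) (x y z : hom A X),
    related R x y -> related R y z -> related R x z.
Proof.
split.
- intros H A x y z Hxy Hyz; exact (related_le H (rcomp_intro Hxy Hyz)).
- intro H; apply sub_le_related; intros A x z Hxz.
  apply related_rcomp in Hxz; destruct Hxz as (B & e & y & He & Hxy & Hyz).
  exact (He _ _ _ _ _ (H _ _ _ _ Hxy Hyz)).
Qed.

(** * Relations of the form [U°U] *)

Lemma gram_intro (X Y A : C) (U : relation X Y) (x y : hom A X) (p : hom A Y) :
  related U x p -> related U y p -> related (rcomp (opp U) U) x y.
Proof.
intros Hx Hy; apply rcomp_intro with p; [exact Hx|].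
apply related_opp; exact Hy.
Qed.

Lemma gram_elim (X Y A : C) (U : relation X Y) (x y : hom A X) :
  related (rcomp (opp U) U) x y ->
  exists (B : C) (e : hom B A) (p : hom B Y),
    cover e /\ related U (x ∘ e) p /\ related U (y ∘ e) p.
Proof.
intro H; apply related_rcomp in H; destruct H as (B & e & p & He & Hx & Hy).
exists B, e, p; rewrite related_opp in Hy; auto.
Qed.

Lemma gram_positive (X Y : C) (U : relation X Y) : positive (rcomp (opp U) U).
Proof. exists Y, U; split; exists (idm _); apply comp_id_r. Qed.

Lemma gram_reflexive (X : C) (E : relation X X) :
  reflexive E -> reflexive (rcomp (opp E) E).
Proof.
intro H; apply related_reflexive; intros A x.
apply gram_intro with x; apply reflexive_related; exact H.
Qed.

Lemma positive_symmetric (X : C) (P : relation X X) : positive P -> symmetric P.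
Proof.
intros (Y & U & H1 & H2); apply related_symmetric; intros A x y Hxy.
apply (related_le H1), gram_elim in Hxy; destruct Hxy as (B & e & p & He & Hx & Hy).
apply He, (related_le H2).
exact (gram_intro Hy Hx).
Qed.

(** * From the Shifting Lemma to 3-permutability *)

Definition positive_shifting : Prop :=
  forall (X : C) (S R T : relation X X),
    reflexive S -> reflexive R -> positive R -> reflexive T -> positive T ->
    shifting_lemma R S T.

(** A common [E]-successor [p] of [u] and [v] serves as both [x] and [y] of the
    Shifting Lemma for [R = E°E], [S = E°] and [T = EE°]. *)
Lemma shifting_swap (X : C) (E : relation X X) :
  positive_shifting -> reflexive E ->
  sub_le (rcomp (opp E) E) (rcomp (opp (opp E)) (opp E)).
Proof.
intros HS HE; apply sub_le_related; intros A u v Huv.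
assert (HE' : reflexive (opp E)).
{ apply related_reflexive; intros B x.
  apply related_opp, reflexive_related; exact HE. }
pose proof (gram_elim Huv) as (B & e & p & He & Hu & Hv).
apply He.
apply (HS X (opp E) (rcomp (opp E) E) (rcomp (opp (opp E)) (opp E)))
  with (x := p) (y := p).
- exact HE'.
- apply gram_reflexive; exact HE.
- apply gram_positive.
- apply gram_reflexive; exact HE'.
- apply gram_positive.
(* [R ∧ E° ≤ EE°] because already [E° ≤ EE°], by reflexivity of [E]. *)
- apply sub_le_related; intros D a b Hab.
  apply related_meet in Hab; destruct Hab as [_ Hab].
  apply gram_intro with b; [exact Hab | apply reflexive_related; exact HE'].
- apply related_meet; split;
    apply reflexive_related, gram_reflexive; assumption.
- apply related_opp; exact Hu.
- apply related_opp; exact Hv.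
- exact (related_comp e Huv).
Qed.

(** The exchange [E°E ≤ EE°] is applied to [E = SR]: reflexivity of [S] gives
    [RSR ≤ RSSR = E°E], and transitivity of [R] gives [EE° = SRRS ≤ SRS]. *)
Lemma shifting_permute (X : C) (R S : relation X X) :
  positive_shifting -> equivalence R -> equivalence S ->
  sub_le (rcomp R (rcomp S R)) (rcomp S (rcomp R S)).
Proof.
intros HS (Rr & Rs & Rt) (Sr & Ss & St).
rewrite related_symmetric in Rs, Ss; rewrite related_transitive in Rt.
assert (HE : reflexive (rcomp S R)).
{ apply related_reflexive; intros A x.
  apply rcomp_intro with x; apply reflexive_related; assumption. }
apply sub_le_related; intros A u v Huv.
apply related_rcomp in Huv; destruct Huv as (B & e & p & He & Hup & Hpv).
apply He.
assert (H : related (rcomp (opp (rcomp S R)) (rcomp S R)) (u ∘ e) (v ∘ e)).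
{ apply gram_intro with p; [exact Hup|].
  apply rcomp_intro with p; [exact (Rs _ _ _ Hpv)|].
  apply reflexive_related; exact Sr. }
apply (related_le (shifting_swap HS HE)), gram_elim in H.
destruct H as (B1 & e1 & q & He1 & Hu & Hv).
apply He1.
rewrite related_opp in Hu, Hv.
apply related_rcomp in Hu; destruct Hu as (B2 & e2 & a & He2 & Hqa & Hau).
apply He2.
apply (related_comp e2), related_rcomp in Hv.
destruct Hv as (B3 & e3 & b & He3 & Hqb & Hbv).
apply He3.
apply rcomp_intro with b; [|exact Hbv].
apply rcomp_intro with (a ∘ e3).
- apply Ss, related_comp; exact Hau.
- apply Rt with (q ∘ e2 ∘ e3); [|exact Hqb].
  apply Rs, related_comp; exact Hqa.
Qed.

(** * 3-permutability as an exchange of zigzags *)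

Lemma kernel_pair_monic (D Y : C) (f : hom D Y) : monic (pairing (pb1 f f) (pb2 f f)).
Proof.
destruct (pullbackP f f) as [Sq U].
intros A g h E; rewrite !pairing_comp in E.
pose proof (f_equal (fun k => pr1 _ _ ∘ k) E) as E1.
pose proof (f_equal (fun k => pr2 _ _ ∘ k) E) as E2.
simpl in E1, E2; rewrite !pr1_pairing in E1; rewrite !pr2_pairing in E2.
destruct (U A (pb1 f f ∘ h) (pb2 f f ∘ h)) as (k & _ & Uk).
{ rewrite !comp_assoc, Sq; reflexivity. }
rewrite <- (Uk g (conj E1 E2)); apply Uk; split; reflexivity.
Qed.

Definition kernel_pair (D Y : C) (f : hom D Y) : relation D D :=
  Subobject (@kernel_pair_monic D Y f).

Lemma related_kernel_pair (D Y A : C) (f : hom D Y) (a b : hom A D) :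
  related (kernel_pair f) a b <-> f ∘ a = f ∘ b.
Proof.
destruct (pullbackP f f) as [Sq U].
rewrite relatedP; unfold leg1, leg2; simpl; rewrite pr1_pairing, pr2_pairing.
split.
- intros (k & <- & <-); rewrite !comp_assoc, Sq; reflexivity.
- intro E; destruct (U A a b E) as (k & Ek & _); exists k; exact Ek.
Qed.

Lemma kernel_pair_equivalence (D Y : C) (f : hom D Y) : equivalence (kernel_pair f).
Proof.
split; [|split].
- apply related_reflexive; intros A x; apply related_kernel_pair; reflexivity.
- apply related_symmetric; intros A x y H.
  rewrite related_kernel_pair in *; symmetry; exact H.
- apply related_transitive; intros A x y z Hxy Hyz.
  rewrite related_kernel_pair in *; rewrite Hxy; exact Hyz.
Qed.

(** This is 3-permutability of the kernel pairs of [f] and [g], read through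
    elements: the only form in which the Goursat property is used. *)
Lemma goursat_zigzag (D Y Z A : C) (f : hom D Y) (g : hom D Z)
    (d0 d1 d2 d3 : hom A D) :
  goursat C -> f ∘ d0 = f ∘ d1 -> g ∘ d1 = g ∘ d2 -> f ∘ d2 = f ∘ d3 ->
  exists (B : C) (e : hom B A) (c1 c2 : hom B D),
    cover e /\
    g ∘ (d0 ∘ e) = g ∘ c1 /\ f ∘ c1 = f ∘ c2 /\ g ∘ c2 = g ∘ (d3 ∘ e).
Proof.
intros HG E01 E12 E23.
rewrite <- related_kernel_pair in E01, E12, E23.
pose proof (rcomp_intro (rcomp_intro E01 E12) E23) as H.
apply (related_le (proj1 (HG _ _ _ (kernel_pair_equivalence f) (kernel_pair_equivalence g))))
  in H.
apply related_rcomp in H; destruct H as (B1 & e1 & c2 & He1 & H & H23).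
apply related_rcomp in H; destruct H as (B2 & e2 & c1 & He2 & H01 & H12).
apply (related_comp e2) in H23.
rewrite <- comp_assoc in H01, H23.
rewrite related_kernel_pair in H01, H12, H23.
exists B2, (e1 ∘ e2), c1, (c2 ∘ e2).
split; [exact (cover_comp He1 He2)|]; auto.
Qed.

(** * From 3-permutability to the Shifting Lemma *)

(** If [a U p], [b U p], [b U q] and [c U q], these four elements of [U] form a
    zigzag for its two legs; the exchanged zigzag is [(a, r)], [(c, r)] for some
    [r]. *)
Lemma goursat_positive_transitive (X : C) (P : relation X X) :
  goursat C -> positive P -> transitive P.
Proof.
intros HG (Y & U & H1 & H2); apply related_transitive.
intros A a b c Hab Hbc.
apply (related_le H1), gram_elim in Hab.
destruct Hab as (B & e & p & He & Hap & Hbp); apply He.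
apply (related_le H1), (related_comp e), gram_elim in Hbc.
destruct Hbc as (B1 & e1 & q & He1 & Hbq & Hcq); apply He1.
apply (related_comp e1), relatedP in Hap; destruct Hap as (d0 & E0 & F0).
apply (related_comp e1), relatedP in Hbp; destruct Hbp as (d1 & E1 & F1).
apply relatedP in Hbq; destruct Hbq as (d2 & E2 & F2).
apply relatedP in Hcq; destruct Hcq as (d3 & E3 & F3).
destruct (@goursat_zigzag _ _ _ _ (leg2 U) (leg1 U) d0 d1 d2 d3 HG)
  as (B2 & e2 & c1 & c2 & He2 & K1 & K2 & K3); try congruence.
apply He2, (related_le H2), gram_intro with (leg2 U ∘ c1).
- rewrite <- E0, <- comp_assoc, K1; apply related_legs.
- rewrite <- E3, <- comp_assoc, <- K3, K2; apply related_legs.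
Qed.

(** The object of quadruples [(z, m, w, t)] with [z S m], [z Q w] and [m R t],
    built as an iterated pullback. *)
Lemma quadruples (X : C) (S Q R : relation X X) :
  exists (D : C) (z m w t : hom D X),
    (related S z m /\ related Q z w /\ related R m t) /\
    forall (A : C) (z' m' w' t' : hom A X),
      related S z' m' -> related Q z' w' -> related R m' t' ->
      exists d : hom A D, z ∘ d = z' /\ m ∘ d = m' /\ w ∘ d = w' /\ t ∘ d = t'.
Proof.
destruct (pullbackP (leg1 S) (leg1 Q)) as [Sq1 U1].
set (p := pb1 (leg1 S) (leg1 Q)) in *; set (q := pb2 (leg1 S) (leg1 Q)) in *.
destruct (pullbackP (leg2 S ∘ p) (leg1 R)) as [Sq2 U2].
set (i := pb1 (leg2 S ∘ p) (leg1 R)) in *; set (r := pb2 (leg2 S ∘ p) (leg1 R)) in *.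
exists (pullback (leg2 S ∘ p) (leg1 R)),
  (leg1 S ∘ (p ∘ i)), (leg2 S ∘ (p ∘ i)), (leg2 Q ∘ (q ∘ i)), (leg2 R ∘ r).
split; [split; [|split]|].
- apply related_legs.
- rewrite comp_assoc, Sq1, <- comp_assoc; apply related_legs.
- rewrite comp_assoc, Sq2; apply related_legs.
- intros A z m w t HS HQ HR; rewrite relatedP in HS, HQ, HR.
  destruct HS as (s & Es1 & Es2), HQ as (k & Ek1 & Ek2), HR as (l & El1 & El2).
  destruct (U1 A s k) as (h & [Eh1 Eh2] & _); [congruence|].
  destruct (U2 A h l) as (d & [Ed1 Ed2] & _).
  { rewrite <- comp_assoc, Eh1; congruence. }
  exists d; rewrite <- !comp_assoc, Ed1, Ed2, Eh1, Eh2; auto.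
Qed.

Lemma goursat_shifting : goursat C -> positive_shifting.
Proof.
intros HG X S R T Sr Rr Rp Tr Tp HRS A x y u v Hxy Hxu Hyv Huv.
pose proof (goursat_positive_transitive HG Rp) as Rt.
pose proof (goursat_positive_transitive HG Tp) as Tt.
apply positive_symmetric in Rp; rename Rp into Rs.
apply positive_symmetric in Tp; rename Tp into Ts.
rewrite related_symmetric in Rs, Ts; rewrite related_transitive in Rt, Tt.
assert (Qr : forall (B : C) (a : hom B X), related (meet R T) a a).
{ intros B a; apply related_meet; split; apply reflexive_related; assumption. }
assert (Hyx : related (meet R T) y x).
{ apply related_meet in Hxy; apply related_meet.
  split; [apply Rs | apply Ts]; apply Hxy. }
destruct (quadruples S (meet R T) R)
  as (D & z & m & w & t & (HS & HQ & HR) & intro_D).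
destruct (intro_D A u u u u) as (d0 & Z0 & M0 & W0 & T0); auto using reflexive_related.
destruct (intro_D A x u x u) as (d1 & Z1 & M1 & W1 & T1); auto using reflexive_related.
destruct (intro_D A y v x u) as (d2 & Z2 & M2 & W2 & T2); auto.
destruct (intro_D A v v v u) as (d3 & Z3 & M3 & W3 & T3); auto using reflexive_related.
destruct (@goursat_zigzag _ _ _ _ m (pairing w t) d0 d1 d2 d3 HG)
  as (B & e & c1 & c2 & He & K1 & K2 & K3);
  [congruence | rewrite !pairing_comp; congruence | congruence |].
apply He.
pose proof (f_equal (fun k => pr1 _ _ ∘ k) K1) as Kw1.
pose proof (f_equal (fun k => pr2 _ _ ∘ k) K1) as Kt1.
pose proof (f_equal (fun k => pr1 _ _ ∘ k) K3) as Kw2.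
pose proof (f_equal (fun k => pr2 _ _ ∘ k) K3) as Kt2.
simpl in Kw1, Kt1, Kw2, Kt2.
rewrite !pairing_comp, !pr1_pairing in Kw1, Kw2.
rewrite !pairing_comp, !pr2_pairing in Kt1, Kt2.
rewrite comp_assoc, W0 in Kw1; rewrite comp_assoc, T0 in Kt1.
rewrite comp_assoc, W3 in Kw2; rewrite comp_assoc, T3 in Kt2.
(* Whenever [w R t], the relation [z R w R t R m] puts [(z, m)] in [R ∧ S]. *)
assert (key : forall c : hom B D,
  related R (w ∘ c) (t ∘ c) -> related T (w ∘ c) (m ∘ c)).
{ intros c Hwt.
  apply (related_comp c) in HS, HQ, HR.
  apply related_meet in HQ; destruct HQ as [HQR HQT].
  apply Tt with (z ∘ c); [exact (Ts _ _ _ HQT)|].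
  apply (related_le HRS), related_meet; split; [|exact HS].
  exact (Rt _ _ _ _ HQR (Rt _ _ _ _ Hwt (Rs _ _ _ HR))). }
apply Tt with (m ∘ c1).
- rewrite Kw1; apply key; rewrite <- Kw1, <- Kt1.
  apply reflexive_related; exact Rr.
- rewrite K2; apply Ts; rewrite <- Kw2; apply key; rewrite Kw2, Kt2.
  apply related_comp, Rs; exact Huv.
Qed.

End Elements.

Theorem theorem3p6 (C : regular_category) :
  goursat C <->
  (forall (X : C) (S R T : relation X X),
     reflexive S ->
     reflexive R -> positive R ->
     reflexive T -> positive T ->
     shifting_lemma R S T).
Proof.
split; [apply goursat_shifting|].
intros HS X R S HR HS'; split; apply shifting_permute; assumption.
Qed.
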